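(* Let $k\ge 1$ and $p\ge 1$ be integers. A $k$-step LIMM method $$\sum_{i=-1}^{k-1} \alpha_i\, y_{n-i} = h_n \sum_{i=0}^{k-1} \beta_i\, f(y_{n-i}) + h_n\, \mathbf{J}_n \left( \sum_{i=-1}^{k-1} \mu_i\, y_{n-i} + h_n \sum_{i=0}^{k-1} \nu_i\, f(y_{n-i}) \right),\qquad \alpha_{-1}=1,$$ with the exact Jacobian $\mathbf{J}_n=f_y(y_n)$, applied on a (generally non-uniform) grid $t_{n-i}=t_n-c_i h_n$, has order of consistency $p$ if and only if its coefficients satisfy $$\sum_{i=-1}^{k-1}\alpha_i=0,\qquad \sum_{i=-1}^{k-1}\mu_i=0\qquad\text{(consistency)},$$ $$\sum_{i=-1}^{k-1}\alpha_i\,c_i+\sum_{i=0}^{k-1}\beta_i=0\qquad\text{(order one)},$$ $$\sum_{i=-1}^{k-1}\alpha_i\,c_i^2+2\sum_{i=-1}^{k-1}\bigl((\beta_i+\mu_i)\,c_i-\nu_i\bigr)=0\qquad\text{(order two; imposed if } p\ge 2),$$ $$\sum_{i=-1}^{k-1}\alpha_i\,c_i^{\ell}+\ell\sum_{i=0}^{k-1}\beta_i\,c_i^{\ell-1}=0\qquad\text{for all } 3\le \ell\le p,$$ $$\sum_{i=-1}^{k-1}\mu_i\,c_i^{\ell-1}-(\ell-1)\sum_{i=0}^{k-1}\nu_i\,c_i^{\ell-2}=0\qquad\text{for all } 3\le \ell\le p,$$ where $\beta_{-1}=\nu_{-1}=0$.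
   Context: The method integrates the initial value problem $y'=f(y)$, $y(t_0)=y_0$, $t_0\le t\le t_F$, with $y(t)\in\mathbb{R}^N$ and $f:\mathbb{R}^N\to\mathbb{R}^N$ sufficiently smooth (autonomous form; a non-autonomous problem is reduced to it by appending $t$ to $y$). Here $y_{n-i}\approx y(t_{n-i})$, $h_n=t_{n+1}-t_n$, and $f_y$ is the Jacobian matrix of $f$. The real coefficients $\alpha_i,\mu_i$ ($i=-1,\dots,k-1$) and $\beta_i,\nu_i$ ($i=0,\dots,k-1$) may depend on the grid fractions $c_j$. The step fractions $c_i$ are defined by $t_{n-i}=t_n-c_i h_n$, so $c_{-1}=-1$, $c_0=0$. The convention $0^0=1$ is used. Order of consistency $p$ (understood for all smooth problems): when the method is started from exact past values $y_{n-i}=y(t_{n-i})$, $i=0,\dots,k-1$ (with $y(\cdot)$ an exact solution of $y'=f(y)$, and hence $\mathbf{J}_n=f_y(y(t_n))$), the resulting $y_{n+1}$ has a Taylor (B-series) expansion about $t_n$ agreeing with that of $y(t_{n+1})$ through all terms of order at most $p$ in $h_n$, i.e. $y_{n+1}-y(t_{n+1})=\mathcal{O}(h_n^{p+1})$ as $h_n\to 0$ with the $c_i$ fixed. *)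

(* Defs.v *)
From mathcomp Require Export all_boot all_order all_algebra.
From mathcomp Require Export all_classical all_reals all_analysis.
Export Order.TTheory GRing.Theory Num.Theory.
Export numFieldNormedType.Exports.

Set Implicit Arguments.
Unset Strict Implicit.
Unset Printing Implicit Defensive.

Local Open Scope classical_set_scope.
Local Open Scope ring_scope.

(* In finite dimension, f is of class C^k iff all iterated directional
   derivatives of order at most k exist and are continuous. *)
Fixpoint class_C (R : realType) (U V : normedModType R) (k : nat)
    (f : U -> V) : Prop :=
  if k is k'.+1 then
    (forall x, differentiable f x) /\ (forall v, class_C k' ('D_v f))
  else continuous f.

Definition smooth (R : realType) (U V : normedModType R) (f : U -> V) : Prop :=
  forall k, class_C k f.

(* The sum of F i over -1 <= i <= k - 1; families indexed by -1, ..., k - 1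
   are functions on int, whose values outside this range are never used. *)
Definition sumN1 (V : nmodType) (k : nat) (F : int -> V) : V :=
  F (-1) + \sum_(0 <= i < k) F i%:Z.

(* The method's equation, with u i standing for y_{n-i}, so that u 0 is y_n and
   u (-1) is the (implicitly determined) new value y_{n+1}. Vectors are rows:
   the product of the Jacobian matrix with v reads v *m 'J f (u 0). *)
Definition limm_step (R : realType) (k : nat) (alpha beta mu nu : int -> R)
    (N : nat) (f : 'rV[R]_N -> 'rV[R]_N) (h : R) (u : int -> 'rV[R]_N) : Prop :=
  sumN1 k (fun i => alpha i *: u i) =
    h *: (\sum_(0 <= i < k) beta i%:Z *: f (u i%:Z)) +
    h *: ((sumN1 k (fun i => mu i *: u i) +
           h *: (\sum_(0 <= i < k) nu i%:Z *: f (u i%:Z))) *m 'J f (u 0)).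

(* y solves y' = f(y) around t = t_n. For each step size h > 0, u h i is
   y_{n-i}; the past values are exact and u h (-1) is what the method returns.
   If alpha (-1) = 1, then for small h the step determines u h (-1) uniquely,
   because 1 - h mu_{-1} f_y(y_n) is then invertible. *)
Definition consistency_order (R : realType) (k : nat)
    (c alpha beta mu nu : int -> R) (p : nat) : Prop :=
  forall (N : nat) (f : 'rV[R]_N -> 'rV[R]_N), smooth f ->
  forall (t : R) (y : R -> 'rV[R]_N),
    (\forall s \near t, is_derive (s : R) (1 : R) y (f (y s))) ->
  forall u : R -> int -> 'rV[R]_N,
    (\forall h \near 0^'+,
       (forall i : nat, (i < k)%N -> u h i%:Z = y (t - c i%:Z * h)) /\
       limm_step k alpha beta mu nu f h (u h)) ->
    (fun h : R => u h (-1) - y (t + h)) =O_ (0^'+) (fun h : R => h ^+ p.+1).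

(* Main.v *)
Require Import Defs.
From mathcomp Require Import ring lra.

(** Insert the exact solution y into the method. Up to sign, the residual, called
    the defect below, differs from the error y_{n+1} - y(t+h) by the factor
    1 - h mu_{-1} J, which is invertible with bounded inverse for small h
    ([resolvent_Opow], [resolvent_exists]); this factor is the whole
    influence of the unknown y_{n+1}, because the method is affine in it. So the
    order of consistency is the order at which the defect vanishes, for every
    smooth problem ([consistency_order_defect]).

    Let d_l be the Taylor coefficients of y at t, and put
    A_l = sum alpha_i c_i^l + l sum beta_i c_i^(l-1) and
    M_l = sum mu_i c_i^l - l sum nu_i c_i^(l-1). Substituting the expansions of y
    and of y' = f(y) gives ([defect_expansion])
      defect(h) = sum_l (-h)^l (A_l d_l + M_{l-1} d_{l-1} J),
    so order p means that A_l d_l + M_{l-1} d_{l-1} J = 0 for all l <= p and all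
    smooth problems.

    The stated conditions are A_0 = 0, A_1 = 0, M_0 = 0, A_2 + 2 M_1 = 0, and
    A_l = M_{l-1} = 0 for l from 3 to p. They suffice because 2 d_2 = d_1 J, which
    is y'' = f_y(y) y'. They are necessary because of two test problems: y' = y
    yields A_0 = 0 and A_l + l M_{l-1} = 0
    ([consistency_moment_combination]), and the solution (x, x^l), whose
    Jacobian at the origin is zero unless l = 2, yields A_l = 0 for all other
    l >= 1 ([consistency_moment_alpha]).

    The existence of the d_l needs no higher derivatives of y. By induction on n,
    the coordinates of g(y) have an n-th order Taylor polynomial for all smooth g
    at once: the derivative of g(y) is a sum of products of such coordinates,
    and the mean value theorem integrates its Taylor polynomial
    ([solution_jet], [solution_expansion]). *)

Set Implicit Arguments.
Unset Strict Implicit.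
Unset Printing Implicit Defensive.

Local Open Scope classical_set_scope.
Local Open Scope ring_scope.

(** * Power bounds at the origin *)

(** phi(x) = O(x^n) along F. The filter is a parameter because Taylor
    remainders are two-sided, so that they can be rescaled by any - c_i and
    evaluated at 0, while step sizes are positive. *)
Definition Opow (R : realType) (V : normedModType R) (F : set_system R)
    (n : nat) (phi : R -> V) : Prop :=
  exists2 C : R, 0 <= C & \forall x \near F, `|phi x| <= C * `|x| ^+ n.

Lemma OpowP (R : realType) (V : normedModType R) (n : nat) (phi : R -> V) :
  phi =O_ (0^'+) (fun h : R => h ^+ n) <-> Opow 0^'+ n phi.
Proof.
split.
  move=> /eqO_exP[C C0 H]; exists C; first exact: ltW.
  by near=> x; rewrite -normrX; near: x.
move=> [C C0 H]; apply/eqO_exP; exists (C + 1); first exact: ltr_wpDl.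
near=> x; rewrite normrX mulrDl mul1r.
have: `|phi x| <= C * `|x| ^+ n by near: x.
by move=> /le_trans; apply; rewrite lerDl exprn_ge0.
Unshelve. all: by end_near. Qed.

Lemma Opow_near (R : realType) (V : normedModType R) (F : set_system R)
    {FF : Filter F} (n : nat) (phi psi : R -> V) :
  (\forall x \near F, phi x = psi x) -> Opow F n phi -> Opow F n psi.
Proof.
move=> E [C C0 H]; exists C => //; near=> x.
have <- : phi x = psi x by near: x.
by near: x.
Unshelve. all: by end_near. Qed.

Lemma Opow_eq (R : realType) (V : normedModType R) (F : set_system R)
    {FF : Filter F} (n : nat) (phi psi : R -> V) :
  phi =1 psi -> Opow F n phi -> Opow F n psi.
Proof. by move=> E; apply: Opow_near; exact: nearW. Qed.

Lemma Opow0 (R : realType) (V : normedModType R) (F : set_system R)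
    {FF : Filter F} (n : nat) : Opow F n (fun=> 0 : V).
Proof. by exists 0 => //; apply: nearW => x; rewrite normr0 mul0r. Qed.

Lemma OpowD (R : realType) (V : normedModType R) (F : set_system R)
    {FF : Filter F} (n : nat) (phi psi : R -> V) :
  Opow F n phi -> Opow F n psi -> Opow F n (fun x => phi x + psi x).
Proof.
move=> [C C0 HC] [D D0 HD]; exists (C + D); first exact: addr_ge0.
near=> x; rewrite (le_trans (ler_normD _ _))// mulrDl lerD//; by near: x.
Unshelve. all: by end_near. Qed.

Lemma Opow_lin (R : realType) (U V : normedModType R) (F : set_system R)
    {FF : Filter F} (n : nat) (L : U -> V) (K : R) (phi : R -> U) :
  (forall u, `|L u| <= K * `|u|) -> Opow F n phi ->
  Opow F n (fun x => L (phi x)).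
Proof.
move=> LK [C C0 HC]; exists (`|K| * C); first exact: mulr_ge0.
near=> x; rewrite (le_trans (LK _))// -mulrA.
rewrite (le_trans (ler_wpM2r (normr_ge0 _) (ler_norm K)))// ler_wpM2l//.
by near: x.
Unshelve. all: by end_near. Qed.

Lemma OpowN (R : realType) (V : normedModType R) (F : set_system R)
    {FF : Filter F} (n : nat) (phi : R -> V) :
  Opow F n phi -> Opow F n (fun x => - phi x).
Proof.
by apply: (@Opow_lin _ _ _ _ _ _ -%R 1) => u; rewrite normrN mul1r.
Qed.

Lemma OpowM (R : realType) (V : normedModType R) (F : set_system R)
    {FF : Filter F} (m n : nat) (a : R -> R) (phi : R -> V) :
  Opow F m a -> Opow F n phi -> Opow F (m + n) (fun x => a x *: phi x).
Proof.
move=> [C C0 HC] [D D0 HD]; exists (C * D); first exact: mulr_ge0.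
near=> x; rewrite normrZ exprD mulrACA ler_pM//; by near: x.
Unshelve. all: by end_near. Qed.

Lemma Opow_sum (R : realType) (V : normedModType R) (F : set_system R)
    {FF : Filter F} (n : nat) (I : Type) (r : seq I) (phi : I -> R -> V) :
  (forall i, Opow F n (phi i)) -> Opow F n (fun x => \sum_(i <- r) phi i x).
Proof.
move=> H; elim: r => [|i r IHr].
  by apply: Opow_eq (Opow0 V n) => x; rewrite big_nil.
by apply: Opow_eq (OpowD (H i) IHr) => x; rewrite big_cons.
Qed.

Lemma Opow_expr (R : realType) (F : set_system R) {FF : Filter F} (n : nat) :
  Opow F n (fun x : R => x ^+ n : R).
Proof. by exists 1 => //; apply: nearW => x; rewrite normrX mul1r. Qed.

Lemma Opow_at0 (R : realType) (V : normedModType R) (n : nat) (phi : R -> V) :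
  Opow (nbhs (0 : R)) n.+1 phi -> phi 0 = 0.
Proof.
move=> [C C0 /nbhs_singleton]; rewrite normr0 expr0n mulr0.
by rewrite normr_le0 => /eqP.
Qed.

Lemma Opow_lower (R : realType) (V : normedModType R) (F : set_system R)
    {FF : Filter F} (m n : nat) (phi : R -> V) :
  F --> (0 : R) -> (m <= n)%N -> Opow F n phi -> Opow F m phi.
Proof.
move=> F0 mn [C C0 H]; exists C => //; near=> x.
have x1 : `|x| <= 1.
  by near: x; apply: F0; exact: (@nbhs0_le _ R 1 ltr01).
have: `|phi x| <= C * `|x| ^+ n by near: x.
by move=> /le_trans; apply; rewrite ler_wpM2l// ler_wiXn2l.
Unshelve. all: by end_near. Qed.

Lemma Opow_cst (R : realType) (V : normedModType R) (F : set_system R)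
    {FF : Filter F} (v : V) : Opow F 0 (fun=> v).
Proof. by exists `|v| => //; apply: nearW => x; rewrite expr0 mulr1. Qed.

Lemma Opow_cont (R : realType) (V : normedModType R) (phi : R -> V) :
  {for 0, continuous phi} -> Opow (nbhs (0 : R)) 0 phi.
Proof.
move=> /cvg_norm cphi; exists (`|phi 0| + 1); first exact: addr_ge0.
near=> x; rewrite expr0 mulr1; apply: ltW.
by near: x; apply: (cvgr_lt `|phi 0|); rewrite ?ltrDl.
Unshelve. all: by end_near. Qed.

Lemma Opow_dilate (R : realType) (V : normedModType R) (n : nat) (a : R)
    (phi : R -> V) :
  Opow (nbhs (0 : R)) n phi -> Opow (nbhs (0 : R)) n (fun x => phi (a * x)).
Proof.
move=> [C C0 HC]; exists (C * `|a| ^+ n).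
  by rewrite mulr_ge0// exprn_ge0.
have c : (fun x : R => a * x) @ (0 : R) --> (0 : R).
  rewrite -[X in _ --> X](mulr0 a); apply: cvgM; [exact: cvg_cst|exact: cvg_id].
near=> x; rewrite -mulrA -exprMn -normrM.
near: x; exact: (c _ HC).
Unshelve. all: by end_near. Qed.

Lemma normr_coord_le (R : realType) (N : nat) (v : 'rV[R]_N) (j : 'I_N) :
  `|v 0 j| <= `|v|.
Proof.
rewrite [leRHS]/Num.Def.normr/= mx_normrE.
exact: (le_bigmax _ (fun i => `|v i.1 i.2|) (0, j)).
Qed.

(** The norm on row vectors is the largest coordinate, so the sum of the
    coordinate constants serves as a common constant. *)
Lemma Opow_coord (R : realType) (N : nat) (F : set_system R)
    {FF : Filter F} (n : nat) (phi : R -> 'rV[R]_N) :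
  (forall j, Opow F n (fun x => phi x 0 j)) -> Opow F n phi.
Proof.
move=> H.
have /choice[C HC] : forall j, exists Cj : R,
    0 <= Cj /\ \forall x \near F, `|phi x 0 j| <= Cj * `|x| ^+ n.
  by move=> j; have [Cj ? ?] := H j; exists Cj.
have S0 : 0 <= \sum_j C j by apply: sumr_ge0 => j _; case: (HC j).
exists (\sum_j C j) => //.
have K : \forall x \near F, forall j, `|phi x 0 j| <= C j * `|x| ^+ n.
  by apply: filter_forall => j; case: (HC j).
near=> x.
have K' j : `|phi x 0 j| <= C j * `|x| ^+ n by move: (j); near: x.
rewrite [leLHS]/Num.Def.normr/= mx_normrE bigmax_le//.
  by rewrite mulr_ge0 ?exprn_ge0.
move=> [i j] _; rewrite ord1 (le_trans (K' j))// ler_wpM2r ?exprn_ge0//.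
rewrite (bigD1 j)//= lerDl sumr_ge0// => l _; by case: (HC l).
Unshelve. all: by end_near. Qed.

(** The mean value theorem gives phi x = psi xi * x with xi between 0 and x, so
    integration gains one power of x. *)
Lemma Opow_primitive (R : realType) (n : nat) (phi psi : R -> R) :
  (\forall x \near (0:R), is_derive x (1:R) phi (psi x)) ->
  phi 0 = 0 -> Opow (nbhs (0 : R)) n psi -> Opow (nbhs (0 : R)) n.+1 phi.
Proof.
move=> D phi0 [C C0 HC]; exists C => //.
have /nbhs_normP[e /= e0 He] : \forall x \near (0 : R),
    is_derive x (1 : R) phi (psi x) /\ `|psi x| <= C * `|x| ^+ n.
  by near=> x; split; near: x.
have {}He x : `|x| < e ->
    is_derive x (1 : R) phi (psi x) /\ `|psi x| <= C * `|x| ^+ n.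
  by move=> xe; apply: He; rewrite /= sub0r normrN.
near=> x.
have xe : `|x| < e. near: x. exact: (@nbhs0_lt _ R e e0).
have cont (a b : R) : (forall z, z \in `[a, b]%R -> `|z| <= `|x|) ->
    {within `[a, b], continuous phi}.
  move=> ab; apply: derivable_within_continuous => z /ab zx.
  by have [dz _] := He z (le_lt_trans zx xe); exact: ex_derive.
(* z is the intermediate point and w is x or - x, according to the sign of x. *)
have fin z w : `|z| <= `|x| -> `|w| = `|x| ->
    phi x = psi z * w \/ phi x = - (psi z * w) ->
    `|phi x| <= C * `|x| ^+ n.+1.
  move=> zx wx H.
  have -> : `|phi x| = `|psi z| * `|x|.
    by case: H => ->; rewrite ?normrN normrM wx.
  rewrite exprSr mulrA ler_wpM2r//.
  have [_ /le_trans] := He z (le_lt_trans zx xe); apply.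
  by rewrite ler_wpM2l// lerXn2r// nnegrE.
have dd (a b : R) : (forall z, z \in `[a, b]%R -> `|z| <= `|x|) -> 
    forall z, z \in `]a, b[%R -> is_derive z (1:R) phi (psi z).
  move=> ab z zab; have [] // := He z (le_lt_trans (ab z _) xe).
  by move: zab; rewrite !in_itv/= => /andP[/ltW-> /ltW->].
have [x0|x0] := leP 0 x.
  have H z : z \in `[0, x]%R -> `|z| <= `|x|.
    by rewrite in_itv/= => /andP[z0 zx]; rewrite !ger0_norm.
  have [z /H zx] := MVT_segment x0 (dd _ _ H) (cont _ _ H).
  rewrite phi0 !subr0 => E; apply: (fin z x zx) => //; by left.
have H z : z \in `[x, 0]%R -> `|z| <= `|x|.
  by rewrite in_itv/= => /andP[z0 zx]; rewrite !ler0_norm ?lerN2// ltW.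
have [z /H zx] := MVT_segment (ltW x0) (dd _ _ H) (cont _ _ H).
rewrite phi0 !sub0r => E; apply: (fin z (- x) zx); first by rewrite normrN.
by right; rewrite -E opprK.
Unshelve. all: by end_near. Qed.

(** * Taylor polynomials of functions of a solution *)

Definition primitive (R : realType) (p : {poly R}) : {poly R} :=
  \poly_(i < (size p).+1) (p`_i.-1 / i%:R).

Lemma coef_primitive (R : realType) (p : {poly R}) (i : nat) :
  (primitive p)`_i = p`_i.-1 / i%:R.
Proof.
rewrite coef_poly; case: i => [|i]; first by rewrite invr0 mulr0.
by rewrite ltnS; case: ltnP => // /(nth_default 0) ->; rewrite mul0r.
Qed.

Lemma deriv_primitive (R : realType) (p : {poly R}) : (primitive p)^`() = p.
Proof.
apply/polyP => i; rewrite coef_deriv coef_primitive.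
by rewrite -[LHS]mulr_natr divfK// pnatr_eq0.
Qed.

Lemma horner_primitive0 (R : realType) (p : {poly R}) : (primitive p).[0] = 0.
Proof. by rewrite horner_coef0 coef_primitive invr0 mulr0. Qed.

(** p need not have degree less than n: leaving it untruncated makes the jet of
    a product the product of the jets. *)
Definition jet (R : realType) (n : nat) (phi : R -> R) (p : {poly R}) : Prop :=
  Opow (nbhs (0 : R)) n (fun x => phi x - p.[x]).

(** phi psi - p q = phi (psi - q) + q (phi - p), and phi and q are bounded
    near 0. *)
Lemma jetM (R : realType) (n : nat) (phi psi : R -> R) (p q : {poly R}) :
  Opow (nbhs (0 : R)) 0 phi -> jet n phi p -> jet n psi q ->
  jet n (fun x => phi x * psi x) (p * q).
Proof.
move=> bphi jp jq.
have bq : Opow (nbhs (0 : R)) 0 (horner q).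
  by apply: Opow_cont; apply: continuous_horner.
apply: Opow_eq (OpowD (OpowM bphi jq) (OpowM bq jp)) => x /=.
by rewrite /GRing.scale /= hornerM; ring.
Qed.

Lemma jet_sum (R : realType) (n N : nat) (phi : 'I_N -> R -> R)
    (p : 'I_N -> {poly R}) :
  (forall i, jet n (phi i) (p i)) ->
  jet n (fun x => \sum_i phi i x) (\sum_i p i).
Proof.
move=> H; rewrite /jet.
have E : (fun x => \sum_i (phi i x - (p i).[x])) =1
  (fun x => \sum_i phi i x - (\sum_i p i).[x]).
  by move=> x; rewrite horner_sum sumrB.
exact: Opow_eq E (Opow_sum _ H).
Qed.

Lemma jet_primitive (R : realType) (n : nat) (phi psi : R -> R) (p : {poly R}) :
  (\forall x \near (0 : R), is_derive x (1 : R) phi (psi x)) ->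
  jet n psi p -> jet n.+1 phi ((phi 0)%:P + primitive p).
Proof.
move=> D jp.
apply: (@Opow_primitive _ _ _ (fun x => psi x - p.[x])) => //; last first.
  by rewrite hornerD hornerC horner_primitive0 addr0 subrr.
near=> x.
have Dx : is_derive x (1 : R) phi (psi x) by near: x.
have := is_deriveB Dx (is_derive_poly ((phi 0)%:P + primitive p) x).
by rewrite derivD derivC add0r deriv_primitive.
Unshelve. all: by end_near. Qed.

(** The chain rule along a curve, one coordinate at a time. *)
Lemma is_derive_comp_coord (R : realType) (N : nat) (g : 'rV[R]_N -> 'rV[R]_N)
    (z : R -> 'rV[R]_N) (x : R) (v : 'rV[R]_N) (j : 'I_N) :
  differentiable g (z x) -> is_derive x (1 : R) z v ->
  is_derive x (1 : R) (fun s => g (z s) 0 j) ('d g (z x) v 0 j).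
Proof.
move=> dg [/derivable1_diffP dz <-].
have dgz : differentiable (g \o z) x by exact: differentiable_comp.
have /derivable1_diffP Dgz := dgz.
have /derivable_mxP Dc := Dgz.
apply: DeriveDef; first exact: Dc.
have := derive_mx Dgz; rewrite deriveE// diff_comp//= (deriveE _ dz) => ->.
by rewrite mxE.
Qed.

Lemma diff_coord_sum (R : realType) (N : nat) (g : 'rV[R]_N -> 'rV[R]_N)
    (x v : 'rV[R]_N) (j : 'I_N) :
  differentiable g x ->
  'd g x v 0 j = \sum_i v 0 i * 'D_(delta_mx 0 i) g x 0 j.
Proof.
move=> dg; rewrite {1}(row_sum_delta v) linear_sum summxE.
by apply: eq_bigr => i _; rewrite linearZ mxE deriveE.
Qed.

Lemma smooth_differentiable (R : realType) (U V : normedModType R) (f : U -> V) x :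
  smooth f -> differentiable f x.
Proof. by move=> /(_ 1)[]. Qed.

Lemma smooth_derive (R : realType) (U V : normedModType R) (f : U -> V) v :
  smooth f -> smooth ('D_v f).
Proof. by move=> sf k; case: (sf k.+1) => _; apply. Qed.

(** Along a solution, the derivative of the coordinate g_j is the sum over i of
    f_i * (D_{e_i} g)_j. All factors are again coordinates of smooth maps, so
    their jets of order n give one of the derivative, and integrating it gives
    a jet of order n + 1 whose formal derivative is the jet of the derivative.
    That last fact is what later identifies the second Taylor coefficient. *)
Lemma solution_jet_succ (R : realType) (n N : nat) (f : 'rV[R]_N -> 'rV[R]_N)
    (z : R -> 'rV[R]_N) :
  smooth f -> (\forall x \near (0 : R), is_derive x (1 : R) z (f (z x))) ->
  (forall (g : 'rV[R]_N -> 'rV[R]_N) (j : 'I_N), smooth g ->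
     exists p, jet n (fun x => g (z x) 0 j) p) ->
  forall (g : 'rV[R]_N -> 'rV[R]_N) (j : 'I_N), smooth g ->
  exists p, jet n.+1 (fun x => g (z x) 0 j) p /\
    jet n (fun x => 'd g (z x) (f (z x)) 0 j) p^`().
Proof.
move=> sf Dz jets g j sg.
have /choice[p Hp] i := jets f i sf.
have /choice[q Hq] i := jets ('D_(delta_mx 0 i) g) j (smooth_derive _ sg).
have J : jet n (fun x => 'd g (z x) (f (z x)) 0 j) (\sum_i p i * q i).
  have E : (fun x => \sum_i f (z x) 0 i * 'D_(delta_mx 0 i) g (z x) 0 j) =
    (fun x => 'd g (z x) (f (z x)) 0 j).
    by apply/funext => x; rewrite diff_coord_sum//; apply: smooth_differentiable.
  rewrite -E; apply: jet_sum => i; apply: jetM => //.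
  apply: Opow_cont.
  have Dz0 := nbhs_singleton Dz.
  have := is_derive_comp_coord i (smooth_differentiable _ sf) Dz0.
  by case=> /derivable1_diffP /differentiable_continuous.
exists ((g (z 0) 0 j)%:P + primitive (\sum_i p i * q i)); split; last first.
  by rewrite derivD derivC add0r deriv_primitive.
apply: jet_primitive J; near=> x.
have Dx : is_derive x (1 : R) z (f (z x)) by near: x.
by apply: is_derive_comp_coord => //; apply: smooth_differentiable.
Unshelve. all: by end_near. Qed.

(** * Taylor expansions of vector-valued functions *)

(** Coefficients are an untruncated sequence, so that one sequence serves all
    orders and no degree has to be tracked. *)
Definition expansion (R : realType) (V : normedModType R) (n : nat)
    (phi : R -> V) (a : nat -> V) : Prop :=
  Opow (nbhs (0 : R)) n (fun x => phi x - \sum_(l < n) x ^+ l *: a l).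

Lemma expansion_eq (R : realType) (V : normedModType R) (n : nat)
    (phi psi : R -> V) (a b : nat -> V) :
  phi =1 psi -> (forall l, (l < n)%N -> a l = b l) ->
  expansion n phi a -> expansion n psi b.
Proof.
move=> E Eab; apply: Opow_eq => x; rewrite E; congr (_ - _).
by apply: eq_bigr => l _; rewrite Eab.
Qed.

Lemma expansionD (R : realType) (V : normedModType R) (n : nat)
    (phi psi : R -> V) (a b : nat -> V) :
  expansion n phi a -> expansion n psi b ->
  expansion n (fun x => phi x + psi x) (fun l => a l + b l).
Proof.
move=> Ha Hb; apply: Opow_eq (OpowD Ha Hb) => x.
rewrite addrACA -opprD -big_split/=; congr (_ - _).
by apply: eq_bigr => l _; rewrite scalerDr.
Qed.

Lemma expansion_linear (R : realType) (U V : normedModType R) (n : nat)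
    (L : {linear U -> V}) (K : R) (phi : R -> U) (a : nat -> U) :
  (forall u, `|L u| <= K * `|u|) -> expansion n phi a ->
  expansion n (L \o phi) (L \o a).
Proof.
move=> LK Ha; apply: Opow_eq (Opow_lin LK Ha) => x /=.
rewrite linearB linear_sum; congr (_ - _).
by apply: eq_bigr => l _; rewrite linearZ.
Qed.

Lemma expansionZ (R : realType) (V : normedModType R) (n : nat) (c : R)
    (phi : R -> V) (a : nat -> V) :
  expansion n phi a -> expansion n (fun x => c *: phi x) (fun l => c *: a l).
Proof.
by apply: (@expansion_linear _ _ _ _ ( *:%R c) `|c|) => u; rewrite normrZ.
Qed.

Lemma expansion_sum (R : realType) (V : normedModType R) (n : nat)
    (I : Type) (r : seq I) (phi : I -> R -> V) (a : I -> nat -> V) :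
  (forall i, expansion n (phi i) (a i)) ->
  expansion n (fun x => \sum_(i <- r) phi i x)
    (fun l => \sum_(i <- r) a i l).
Proof.
move=> H; apply: Opow_eq (Opow_sum r H) => x.
rewrite sumrB exchange_big/=; congr (_ - _).
by apply: eq_bigr => l _; rewrite scaler_sumr.
Qed.

Lemma expansion_dilate (R : realType) (V : normedModType R) (n : nat) (c : R)
    (phi : R -> V) (a : nat -> V) :
  expansion n phi a ->
  expansion n (fun x => phi (c * x)) (fun l => c ^+ l *: a l).
Proof.
move=> Ha; apply: Opow_eq (Opow_dilate c Ha) => x; congr (_ - _).
by apply: eq_bigr => l _; rewrite exprMn mulrC scalerA.
Qed.

(** Multiplication by the step size shifts the coefficients and gains one
    order. *)
Lemma expansion_mulX (R : realType) (V : normedModType R) (n : nat)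
    (phi : R -> V) (a : nat -> V) :
  expansion n phi a -> expansion n.+1 (fun x => x *: phi x)
    (fun l => if l is m.+1 then a m else 0).
Proof.
move=> Ha.
apply: Opow_eq (OpowM (@Opow_expr R (nbhs (0 : R)) _ 1) Ha) => x /=.
rewrite expr1 scalerBr big_ord_recl scaler0 add0r scaler_sumr; congr (_ - _).
by apply: eq_bigr => l _; rewrite exprS scalerA.
Qed.

Lemma expansion_lower (R : realType) (V : normedModType R) (n : nat)
    (phi : R -> V) (a : nat -> V) :
  expansion n.+1 phi a -> expansion n phi a.
Proof.
move=> /(Opow_lower cvg_id (leqnSn n)) Ha.
have Hn : Opow (nbhs (0 : R)) n (fun x : R => x ^+ n *: a n).
  rewrite -[X in Opow _ X]addn0.
  apply: OpowM; first exact: Opow_expr.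
  exact: Opow_cst.
apply: Opow_eq (OpowD Ha Hn) => x /=.
by rewrite big_ord_recr/= opprD addrA subrK.
Qed.

Lemma expansion_at0 (R : realType) (V : normedModType R) (n : nat)
    (phi : R -> V) (a : nat -> V) :
  expansion n.+1 phi a -> a 0 = phi 0.
Proof.
move=> /Opow_at0 /eqP; rewrite subr_eq0 => /eqP ->.
rewrite big_ord_recl expr0 scale1r big1 ?addr0// => i _.
by rewrite expr0n scale0r.
Qed.

Lemma expansion_jets (R : realType) (N n : nat) (phi : R -> 'rV[R]_N)
    (p : 'I_N -> {poly R}) :
  (forall j, jet n (fun x => phi x 0 j) (p j)) ->
  expansion n phi (fun l => \row_j (p j)`_l).
Proof.
move=> H; apply: Opow_coord => j.
have bd : Opow (nbhs (0 : R)) 0 (horner (drop_poly n (p j))).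
  by apply: Opow_cont; apply: continuous_horner.
have Hn : Opow (nbhs (0 : R)) n
    (fun x => x ^+ n *: (drop_poly n (p j)).[x] : R).
  rewrite -[X in Opow _ X]addn0.
  by apply: OpowM => //; exact: Opow_expr.
apply: Opow_eq (OpowD (H j) Hn) => x /=.
rewrite !mxE summxE -{1}(poly_take_drop n (p j)) hornerD hornerM hornerXn.
rewrite horner_poly /GRing.scale /= [_ * x ^+ n]mulrC opprD addrA subrK.
by congr (_ - _); apply: eq_bigr => l _; rewrite !mxE mulrC.
Qed.

(** The induction is over all smooth g at once because the step differentiates
    g. It spares the proof that z itself is smooth. *)
Lemma solution_jet (R : realType) (n N : nat) (f : 'rV[R]_N -> 'rV[R]_N)
    (z : R -> 'rV[R]_N) :
  smooth f -> (\forall x \near (0 : R), is_derive x (1 : R) z (f (z x))) ->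
  forall (g : 'rV[R]_N -> 'rV[R]_N) (j : 'I_N), smooth g ->
    exists p, jet n (fun x => g (z x) 0 j) p.
Proof.
move=> sf Dz; elim: n => [|n IHn] g j sg; last first.
  by have [p [Hp _]] := solution_jet_succ sf Dz IHn j sg; exists p.
have := is_derive_comp_coord j (smooth_differentiable _ sg) (nbhs_singleton Dz).
case=> /derivable1_diffP /differentiable_continuous c _.
by exists 0; apply: Opow_eq (Opow_cont c) => x; rewrite horner0 subr0.
Qed.

(** The expansion of f(z) is the derivative of that of z because z' = f(z). The
    last clause is z'' = f_y(z) z' at 0, the relation through which the
    alpha and mu conditions merge into one at order two. *)
Lemma solution_expansion (R : realType) (n N : nat)
    (f : 'rV[R]_N -> 'rV[R]_N) (z : R -> 'rV[R]_N) :
  smooth f -> (\forall x \near (0 : R), is_derive x (1 : R) z (f (z x))) ->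
  exists d : nat -> 'rV[R]_N, [/\ expansion n.+2 z d,
    expansion n.+1 (f \o z) (fun l => l.+1%:R *: d l.+1) &
    (0 < n)%N -> 2 *: d 2%N = d 1%N *m 'J f (z 0)].
Proof.
move=> sf Dz.
have /choice[p Hp] j := solution_jet_succ sf Dz (solution_jet n sf Dz) j sf.
pose P j := (z 0 0 j)%:P + primitive (p j).
have coefP j l : l.+1%:R * (P j)`_l.+1 = (p j)`_l.
  have <- : (P j)^`() = p j by rewrite derivD derivC add0r deriv_primitive.
  by rewrite coef_deriv mulr_natl.
have Hf : expansion n.+1 (f \o z) (fun l => l.+1%:R *: \row_j (P j)`_l.+1).
  have /expansion_jets : forall j, jet n.+1 (fun x => (f \o z) x 0 j) (p j).
    by move=> j; case: (Hp j).
  by apply: expansion_eq => // l _; apply/rowP => j; rewrite !mxE coefP.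
exists (fun l => \row_j (P j)`_l); split => //.
  apply: expansion_jets => j; have [jp _] := Hp j.
  apply: jet_primitive jp; near=> x.
  have Dx : is_derive x (1 : R) z (f (z x)) by near: x.
  have did : differentiable (@id 'rV[R]_N) (z x) by exact: ex_diff.
  have := is_derive_comp_coord j did Dx.
  by rewrite diff_val.
(* The second coefficient: the jet of the derivative of f(z), evaluated at 0. *)
case: n p P coefP Hp Hf => // n p P coefP Hp Hf _.
have E : \row_j (P j)`_1 = f (z 0).
  by have /= := expansion_at0 Hf; rewrite scale1r.
rewrite E /jacobian mul_rV_lin1; apply/rowP => j; rewrite !mxE coefP.
have [_ /Opow_at0 /= /eqP] := Hp j.
by rewrite subr_eq0 => /eqP ->; rewrite horner_coef0 coef_deriv.
Unshelve. all: by end_near. Qed.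

(** * Uniqueness of expansions and the implicit equation *)

Lemma Opow_right (R : realType) (V : normedModType R) (n : nat)
    (phi : R -> V) : Opow (nbhs (0 : R)) n phi -> Opow 0^'+ n phi.
Proof. by move=> [C C0 H]; exists C => //; apply: cvg_within. Qed.

(** Letting x tend to 0 kills the constant term; then divide by x and
    repeat. *)
Lemma polynomial_Opow_eq0 (R : realType) (V : normedModType R) (n : nat)
    (a : nat -> V) :
  Opow 0^'+ n (fun x : R => \sum_(l < n) x ^+ l *: a l) ->
  forall l, (l < n)%N -> a l = 0.
Proof.
elim: n a => [//|n IHn] a H.
have r0 : (0 : R)^'+ --> (0 : R) by exact: cvg_within.
have a0 : a 0 = 0.
  have tail : Opow 0^'+ 1 (fun x : R => \sum_(l < n) x ^+ l.+1 *: a l.+1).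
    apply: Opow_sum => l; apply: (@Opow_lower _ _ _ _ 1 (l.+1 + 0)) => //.
    by apply: OpowM; [exact: Opow_expr|exact: Opow_cst].
  have [C C0 HC] : Opow 0^'+ 1 (fun=> a 0).
    apply: Opow_eq (OpowD (Opow_lower r0 _ H) (OpowN tail)) => // x.
    by rewrite big_ord_recl expr0 scale1r addrK.
  apply/eqP; rewrite -normr_le0 leNgt; apply/negP => a0.
  have C1 : 0 < C + 1 by rewrite ltr_wpDl.
  near (0 : R)^'+ => x.
  have x0 : 0 < x by near: x; exact: nbhs_right_gt.
  have : x < `|a 0| / (C + 1).
    by near: x; apply: nbhs_right_lt; rewrite divr_gt0.
  rewrite ltr_pdivlMr//; apply/negP; rewrite -leNgt.
  have : `|a 0| <= C * `|x| ^+ 1 by near: x.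
  rewrite expr1 gtr0_norm// => /le_trans; apply.
  by rewrite mulrC ler_wpM2l ?lerDl// ltW.
move=> [//|l]; rewrite ltnS; apply: (IHn (fun l => a l.+1)) => {l}.
have [C C0 HC] := H; exists C => //; near=> x.
have x0 : 0 < x by near: x; exact: nbhs_right_gt.
have : `|\sum_(l < n.+1) x ^+ l *: a l| <= C * `|x| ^+ n.+1 by near: x.
rewrite big_ord_recl a0 scaler0 add0r.
under eq_bigr do rewrite exprS -scalerA.
by rewrite -scaler_sumr normrZ exprS mulrCA ler_pM2l// normr_gt0 gt_eqF.
Unshelve. all: by end_near. Qed.

Lemma expansion_Opow (R : realType) (V : normedModType R) (n : nat)
    (phi : R -> V) (a : nat -> V) :
  expansion n phi a ->
  Opow 0^'+ n phi <-> (forall l, (l < n)%N -> a l = 0).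
Proof.
move=> /Opow_right Ha; split=> [Hphi|a0].
  apply: polynomial_Opow_eq0.
  by apply: Opow_eq (OpowD Hphi (OpowN Ha)) => x; rewrite opprB addrC subrK.
apply: Opow_eq Ha => x; rewrite big1 ?subr0// => l _.
by rewrite a0 ?scaler0.
Qed.

Lemma mulmx_bounded (R : realType) (N : nat) (J : 'M[R]_N) :
  exists2 K : R, 0 <= K & forall v : 'rV[R]_N, `|v *m J| <= K * `|v|.
Proof.
exists (\sum_j \sum_i `|J i j|).
  by apply: sumr_ge0 => j _; apply: sumr_ge0.
move=> v; rewrite [leLHS]/Num.Def.normr/= mx_normrE bigmax_le//.
  by rewrite mulr_ge0// sumr_ge0// => j _; apply: sumr_ge0.
move=> [i j] _; rewrite ord1 mxE (le_trans (ler_norm_sum _ _ _))//.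
apply: (@le_trans _ _ ((\sum_i0 `|J i0 j|) * `|v|)).
  rewrite mulr_suml ler_sum// => l _.
  by rewrite normrM mulrC ler_wpM2l// normr_coord_le.
rewrite ler_wpM2r// [leRHS](bigD1 j)//= lerDl sumr_ge0// => l _.
exact: sumr_ge0.
Qed.

(** Here e is the error of one step, rho the defect and J the Jacobian. For
    small h the operator 1 - h m J is within 1/2 of the identity, so that e and
    rho bound each other up to constants. *)
Lemma resolvent_Opow (R : realType) (N n : nat) (m : R) (J : 'M[R]_N)
    (e rho : R -> 'rV[R]_N) :
  (\forall h \near 0^'+, e h - h *: (m *: (e h *m J)) = - rho h) ->
  Opow 0^'+ n e <-> Opow 0^'+ n rho.
Proof.
move=> E; have [K K0 HK] := mulmx_bounded (m *: J).
have B h : `|m *: (e h *m J)| <= K * `|e h|.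
  by rewrite scalemxAr.
have K1 : 0 < K + 1 by rewrite ltr_wpDl.
split=> -[C C0 HC].
  exists ((1 + K) * C); first by rewrite mulr_ge0// addr_ge0.
  near=> h.
  have h0 : 0 < h by near: h; exact: nbhs_right_gt.
  have h1 : h <= 1 by near: h; exact: nbhs_right_le.
  rewrite -normrN; have <- : e h - h *: (m *: (e h *m J)) = - rho h by near: h.
  rewrite (le_trans (ler_normB _ _))// normrZ gtr0_norm//.
  apply: (@le_trans _ _ ((1 + K) * `|e h|)).
    rewrite mulrDl mul1r lerD2l (le_trans _ (B h))//.
    by rewrite ler_piMl.
  rewrite -mulrA ler_wpM2l ?addr_ge0//.
  rewrite -{2}(gtr0_norm h0); by near: h.
exists (2 * C); first by rewrite mulr_ge0.
near=> h.
have h0 : 0 < h by near: h; exact: nbhs_right_gt.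
have h1 : h <= (2 * (K + 1))^-1.
  by near: h; apply: nbhs_right_le; rewrite invr_gt0 mulr_gt0.
have hK : h * K <= 2^-1.
  apply: (@le_trans _ _ (h * (K + 1))).
    by rewrite ler_wpM2l ?lerDl// ltW.
  by rewrite -ler_pdivlMr// -invfM.
have Eh : e h = - rho h + h *: (m *: (e h *m J)).
  have <- : e h - h *: (m *: (e h *m J)) = - rho h by near: h.
  by rewrite subrK.
have : `|e h| <= `|rho h| + 2^-1 * `|e h|.
  rewrite {1}Eh (le_trans (ler_normD _ _))// normrN lerD2l normrZ gtr0_norm//.
  rewrite (le_trans (ler_wpM2l _ (B h))) ?(ltW h0)// mulrA.
  by rewrite ler_wpM2r.
have : `|rho h| <= C * `|h| ^+ n by near: h.
rewrite -mulrA; set X := `|e h|; set Y := `|rho h|; set Z := C * _.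
by move: X Y Z => X Y Z; lra.
Unshelve. all: by end_near. Qed.

(** For small h the matrix 1 - h m J is invertible: a kernel vector v would
    satisfy |v| <= h K |v| with h K < 1. *)
Lemma resolvent_exists (R : realType) (N : nat) (m : R) (J : 'M[R]_N)
    (rho : R -> 'rV[R]_N) :
  exists e : R -> 'rV[R]_N,
    \forall h \near 0^'+, e h - h *: (m *: (e h *m J)) = - rho h.
Proof.
exists (fun h => - rho h *m invmx (1%:M - (h * m) *: J)).
have [K K0 HK] := mulmx_bounded (m *: J).
have K1 : 0 < K + 1 by rewrite ltr_wpDl.
near=> h.
have h0 : 0 < h by near: h; exact: nbhs_right_gt.
have h1 : h < (K + 1)^-1.
  by near: h; apply: nbhs_right_lt; rewrite invr_gt0.
set A := 1%:M - (h * m) *: J.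
have resE v : v - h *: (m *: (v *m J)) = v *m A.
  by rewrite mulmxBr mulmx1 -scalemxAr scalerA.
suff uA : A \in unitmx by rewrite resE mulmxKV.
rewrite unitmxE unitfE; apply/det0P => -[v v0].
rewrite -resE => /eqP; rewrite subr_eq0 => /eqP Ev.
have nv0 : 0 < `|v| by rewrite normr_gt0.
have : `|v| <= h * K * `|v|.
  by rewrite {1}Ev normrZ gtr0_norm// -mulrA ler_wpM2l ?(ltW h0)// scalemxAr.
rewrite -{1}[`|v|]mul1r ler_pM2r//; apply/negP; rewrite -ltNge.
apply: (@le_lt_trans _ _ (h * (K + 1))).
  by rewrite ler_wpM2l ?lerDl// ltW.
by rewrite -ltr_pdivlMr// div1r.
Unshelve. all: by end_near. Qed.

(** * The defect of the exact solution *)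

(** The two halves of the method, the one with (alpha, - beta) and the one with
    (mu, nu) multiplied by the Jacobian, have this same shape. *)
Definition stage (R : realType) (k : nat) (a b : int -> R) (N : nat)
    (f : 'rV[R]_N -> 'rV[R]_N) (h : R) (u : int -> 'rV[R]_N) : 'rV[R]_N :=
  sumN1 k (fun i => a i *: u i) +
  h *: (\sum_(0 <= i < k) b i%:Z *: f (u i%:Z)).

Definition defect (R : realType) (k : nat) (alpha beta mu nu : int -> R)
    (N : nat) (f : 'rV[R]_N -> 'rV[R]_N) (h : R) (u : int -> 'rV[R]_N) :=
  stage k alpha (fun i => - beta i) f h u -
  h *: (stage k mu nu f h u *m 'J f (u 0)).

(** Up to sign, the coefficient produced by stage a b at the l-th Taylor
    coefficient of the solution. For l = 0 the exponent l.-1 is harmless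
    because of the factor l. *)
Definition moment (R : realType) (k : nat) (c a b : int -> R) (l : nat) : R :=
  sumN1 k (fun i => a i * c i ^+ l) -
  l%:R * \sum_(0 <= i < k) b i%:Z * c i%:Z ^+ l.-1.

Lemma limm_step_defect (R : realType) (k : nat) (alpha beta mu nu : int -> R)
    (N : nat) (f : 'rV[R]_N -> 'rV[R]_N) (h : R) (u : int -> 'rV[R]_N) :
  limm_step k alpha beta mu nu f h u <->
  defect k alpha beta mu nu f h u = 0.
Proof.
rewrite /limm_step /defect /stage.
under [in X in _ <-> X]eq_bigr do rewrite scaleNr.
rewrite sumrN scalerN -[X in _ <-> X = _]addrA -opprD.
by split=> [->|/eqP]; rewrite ?subrr// subr_eq0 => /eqP.
Qed.

(** The method is affine in the new value y_{n+1}, which enters through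
    alpha_{-1} = 1 and through h mu_{-1} J only; f is evaluated at past values
    only. *)
Lemma defect_future (R : realType) (k : nat) (alpha beta mu nu : int -> R)
    (N : nat) (f : 'rV[R]_N -> 'rV[R]_N) (h : R) (u w : int -> 'rV[R]_N) :
  (0 < k)%N -> alpha (-1) = 1 ->
  (forall i : nat, (i < k)%N -> u i%:Z = w i%:Z) ->
  defect k alpha beta mu nu f h u = defect k alpha beta mu nu f h w +
    ((u (-1) - w (-1)) - h *: (mu (-1) *: ((u (-1) - w (-1)) *m 'J f (w 0)))).
Proof.
move=> k0 a1 uw.
have stageB a b : stage k a b f h u =
    stage k a b f h w + a (-1) *: (u (-1) - w (-1)).
  rewrite /stage /sumN1.
  have -> : \sum_(0 <= i < k) a i%:Z *: u i%:Z =
      \sum_(0 <= i < k) a i%:Z *: w i%:Z.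
    by apply: eq_big_nat => i /andP[_ ik]; rewrite uw.
  have -> : \sum_(0 <= i < k) b i%:Z *: f (u i%:Z) =
      \sum_(0 <= i < k) b i%:Z *: f (w i%:Z).
    by apply: eq_big_nat => i /andP[_ ik]; rewrite uw.
  rewrite scalerBr; set X := _ *: u _; set Y := _ *: w _.
  by rewrite [RHS]addrC [in RHS]addrA [in RHS]addrA subrK.
rewrite /defect !stageB a1 scale1r (uw 0 k0) mulmxDl scalerDr -scalemxAl.
by rewrite opprD addrACA.
Qed.

(** Put x = - c_i h in z(x) = sum x^l d_l and f(z(x)) = sum (l+1) x^l d_{l+1}
    and collect powers of h. *)
Lemma stage_expansion (R : realType) (k : nat) (c a b : int -> R) (N n : nat)
    (f : 'rV[R]_N -> 'rV[R]_N) (z : R -> 'rV[R]_N) (d : nat -> 'rV[R]_N) :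
  expansion n.+1 z d -> expansion n (f \o z) (fun l => l.+1%:R *: d l.+1) ->
  expansion n.+1 (fun h => stage k a b f h (fun i => z (- c i * h)))
    (fun l => (-1) ^+ l *: (moment k c a b l *: d l)).
Proof.
move=> Hz Hf.
have Ez i := expansionZ (a i) (expansion_dilate (- c i) Hz).
have Ef (i : nat) := expansionZ (b i%:Z) (expansion_dilate (- c i%:Z) Hf).
have := expansionD (expansionD (Ez (-1))
  (expansion_sum (index_iota 0 k) (fun i : nat => Ez i%:Z)))
  (expansion_mulX (expansion_sum (index_iota 0 k) Ef)).
apply: expansion_eq => // l _.
have Ea : a (-1) *: ((- c (-1)) ^+ l *: d l) +
    \sum_(0 <= i < k) a i%:Z *: ((- c i%:Z) ^+ l *: d l) =
    ((-1) ^+ l * sumN1 k (fun i => a i * c i ^+ l)) *: d l.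
  under eq_bigr do rewrite scalerA.
  rewrite scalerA -scaler_suml -scalerDl; congr (_ *: _).
  rewrite mulrDr mulr_sumr [(- c _) ^+ _]exprNn; congr (_ + _); first by ring.
  by apply: eq_bigr => i _; rewrite [(- c _) ^+ _]exprNn; ring.
rewrite Ea scalerA; case: l Ea => [|l] _.
  by rewrite /moment mul0r subr0 addr0.
under eq_bigr do rewrite !scalerA.
rewrite -scaler_suml -scalerDl; congr (_ *: _).
rewrite /moment mulrBr; congr (_ + _); rewrite mulrA mulr_sumr -sumrN.
by apply: eq_bigr => i _; rewrite [(- c _) ^+ _]exprNn /= exprS; ring.
Qed.

(** Up to the sign (-1)^l, the coefficient of h^l in the defect. The factor h in
    front of the Jacobian shifts the mu part by one. *)
Definition defect_coef (R : realType) (k : nat) (c alpha beta mu nu : int -> R)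
    (N : nat) (J : 'M[R]_N) (d : nat -> 'rV[R]_N) (l : nat) : 'rV[R]_N :=
  moment k c alpha (fun i => - beta i) l *: d l +
  if l is m.+1 then moment k c mu nu m *: (d m *m J) else 0.

Lemma defect_expansion (R : realType) (k : nat) (c alpha beta mu nu : int -> R)
    (c0 : c 0 = 0) (N n : nat)
    (f : 'rV[R]_N -> 'rV[R]_N) (z : R -> 'rV[R]_N) (d : nat -> 'rV[R]_N) :
  expansion n.+2 z d -> expansion n.+1 (f \o z) (fun l => l.+1%:R *: d l.+1) ->
  expansion n.+2
    (fun h => defect k alpha beta mu nu f h (fun i => z (- c i * h)))
    (fun l => (-1) ^+ l *:
      defect_coef k c alpha beta mu nu ('J f (z 0)) d l).
Proof.
move=> Hz Hf.
have Ha := stage_expansion k c alpha (fun i => - beta i) Hz Hf.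
have Hm := stage_expansion k c mu nu (expansion_lower Hz) (expansion_lower Hf).
have [K _ HK] := mulmx_bounded ('J f (z 0)).
have HJ := expansion_linear (L := mulmxr ('J f (z 0))) HK Hm.
have := expansionD Ha (expansionZ (-1) (expansion_mulX HJ)).
apply: expansion_eq => [h|l _].
  by rewrite /defect c0 oppr0 mul0r scaleN1r.
rewrite /defect_coef scalerDr; congr (_ + _).
case: l => [|l]; first by rewrite !scaler0.
by rewrite /= -!scalemxAl exprS -scalerA.
Qed.

(** * Consistency in terms of the defect *)

Lemma is_derive_translate (R : realType) (V : normedModType R) (y : R -> V)
    (t x : R) (v : V) :
  is_derive (t + x) (1 : R) y v -> is_derive x (1 : R) (fun s => y (t + s)) v.
Proof.
have E : (fun h : R => h^-1 *: (y (t + (h *: 1 + x)) - y (t + x))) =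
    (fun h : R => h^-1 *: (y (h *: 1 + (t + x)) - y (t + x))).
  by apply/funext => h; rewrite addrCA.
move=> [dy yv]; apply: DeriveDef; first by rewrite /derivable /= E.
by rewrite -yv /derive /= E.
Qed.

Lemma solution_translate (R : realType) (N : nat) (f : 'rV[R]_N -> 'rV[R]_N)
    (t : R) (y : R -> 'rV[R]_N) :
  (\forall s \near t, is_derive (s : R) (1 : R) y (f (y s))) ->
  \forall x \near (0 : R),
    is_derive x (1 : R) (fun s => y (t + s)) (f (y (t + x))).
Proof.
move=> /nbhs0P H; near=> x; apply: is_derive_translate.
by near: x.
Unshelve. all: by end_near. Qed.

(** By the affine dependence on y_{n+1}, a value y(t+h) + e solves the step if
    and only if (1 - h mu_{-1} J) e is minus the defect. Error and defect are
    therefore of the same order. From left to right the step has to be solved to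
    produce the sequence u to which the definition is applied. *)
Lemma consistency_order_defect (R : realType) (k p : nat) (hk : (0 < k)%N)
    (c alpha beta mu nu : int -> R)
    (cN1 : c (-1) = -1) (c0 : c 0 = 0) (alphaN1 : alpha (-1) = 1) :
  consistency_order k c alpha beta mu nu p <->
  forall (N : nat) (f : 'rV[R]_N -> 'rV[R]_N) (z : R -> 'rV[R]_N), smooth f ->
    (\forall x \near (0 : R), is_derive x (1 : R) z (f (z x))) ->
    Opow 0^'+ p.+1
      (fun h => defect k alpha beta mu nu f h (fun i => z (- c i * h))).
Proof.
split=> [H N f z sf Dz|H N f sf t y Dy u Hu].
  pose rho h := defect k alpha beta mu nu f h (fun i => z (- c i * h)).
  have [e He] := resolvent_exists (mu (-1)) ('J f (z 0)) rho.
  (* The exact past values, and the solution of the implicit equation. *)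
  pose u h i := if i == -1 then z h + e h else z (- c i * h).
  apply/(resolvent_Opow _ He)/OpowP.
  have : (fun h => u h (-1) - z (0 + h)) =O_ (0^'+) (fun h : R => h ^+ p.+1).
    apply: (H N f sf 0 z Dz); near=> h; split=> [i ik|].
      by rewrite /u /= sub0r mulNr.
    apply/limm_step_defect.
    rewrite (@defect_future _ _ _ _ _ _ _ _ _ _ (fun i => z (- c i * h)) hk)//.
    rewrite cN1 opprK mul1r c0 oppr0 mul0r.
    have -> : u h (-1) - z h = e h by rewrite /u /= addrAC subrr add0r.
    have -> : e h - h *: (mu (-1) *: (e h *m 'J f (z 0))) = - rho h by near: h.
    by rewrite subrr.
  have -> : (fun h => u h (-1) - z (0 + h)) = e; last by [].
  by apply/funext => h; rewrite /u /= add0r addrAC subrr add0r.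
have rO := H N f (fun s => y (t + s)) sf (solution_translate Dy).
apply/OpowP; apply/(@resolvent_Opow _ _ _ (mu (-1)) ('J f (y t)) _ _ _).2 : rO.
near=> h.
have [past /limm_step_defect] : (forall i : nat, (i < k)%N ->
    u h i%:Z = y (t - c i%:Z * h)) /\ limm_step k alpha beta mu nu f h (u h).
  by near: h.
rewrite (@defect_future _ _ _ _ _ _ _ _ _ _ (fun i => y (t + - c i * h)) hk)//;
  last first.
  by move=> i ik; rewrite past// mulNr.
rewrite cN1 opprK mul1r c0 oppr0 mul0r addr0 addrC => /eqP.
by rewrite addr_eq0 => /eqP.
Unshelve. all: by end_near. Qed.

(** * Test problems *)

(** A family of right-hand sides which is closed under directional derivatives
    and yet contains all the test problems. *)
Definition ridge (R : realType) (N : nat) (a v : 'rV[R]_N) (i : 'I_N)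
  (q : {poly R}) : 'rV[R]_N -> 'rV[R]_N := fun x => a + q.[x 0 i] *: v.

Lemma diff_ridge (R : realType) (N : nat) (a v x : 'rV[R]_N) (i : 'I_N)
    (q : {poly R}) :
  differentiable (ridge a v i q) x /\
  forall w, 'd (ridge a v i q) x w = (q^`().[x 0 i] * w 0 i) *: v.
Proof.
pose pr (y : 'rV[R]_N) : R := y 0 i.
have dpr : differentiable pr x by exact: differentiable_coord.
have Dpr w : 'd pr x w = w 0 i.
  by have /rowP/(_ i) := derive_mx (@derivable_id _ _ x w);
    rewrite derive_id mxE deriveE.
have dq : differentiable (horner q) (pr x).
  exact/derivable1_diffP/derivable_horner.
have dqp : differentiable (horner q \o pr) x by exact: differentiable_comp.
have dqpv : differentiable (fun y => (horner q \o pr) y *: v) x.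
  exact: differentiableZl.
have E : ridge a v i q = cst a + (fun y => (horner q \o pr) y *: v).
  by apply/funext.
have da : differentiable (cst a : 'rV[R]_N -> 'rV[R]_N) x by exact: ex_diff.
have dE : differentiable (ridge a v i q) x by rewrite E; exact: differentiableD.
split=> // w; rewrite -(deriveE w dE) E.
rewrite (deriveD (diff_derivable da) (diff_derivable dqpv)).
rewrite derive_cst add0r (deriveE w dqpv) (diffZl _ dqp).
rewrite (diff_comp dpr dq) /= Dpr.
by rewrite (diff1E dq) derive1E derive_val mulrC.
Qed.

(** A directional derivative of a ridge function is a ridge function. *)
Lemma smooth_ridge (R : realType) (N : nat) (a v : 'rV[R]_N) (i : 'I_N)
    (q : {poly R}) : smooth (ridge a v i q).
Proof.
move=> k; elim: k a q => [|k IHk] a q /=.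
  by move=> x; apply: differentiable_continuous;
    case: (diff_ridge a v x i q).
split=> [x|w]; first by case: (diff_ridge a v x i q).
have -> : 'D_w (ridge a v i q) = ridge 0 v i (w 0 i *: q^`()).
  apply/funext => x; have [dx E] := diff_ridge a v x i q.
  by rewrite deriveE// E /ridge add0r hornerZ mulrC.
exact: IHk.
Qed.

Lemma jacobian_ridge (R : realType) (N : nat) (a v x w : 'rV[R]_N) (i : 'I_N)
    (q : {poly R}) :
  w *m 'J (ridge a v i q) x = (q^`().[x 0 i] * w 0 i) *: v.
Proof. by rewrite /jacobian mul_rV_lin1; case: (diff_ridge a v x i q). Qed.

Lemma is_derive_scalel (R : realType) (V : normedModType R) (g : R -> R)
    (x dg : R) (v : V) :
  is_derive x (1 : R) g dg ->
  is_derive x (1 : R) (fun s => g s *: v) (dg *: v).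
Proof.
move=> [/derivable1_diffP dfg <-].
have dgv : differentiable (fun s => g s *: v) x by exact: differentiableZl.
apply: DeriveDef; first exact/derivable1_diffP.
by rewrite (deriveE _ dgv) (diffZl v dfg) (deriveE _ dfg).
Qed.

Lemma expansion_monomial (R : realType) (V : normedModType R) (n m : nat)
    (v : V) :
  expansion n (fun x : R => x ^+ m *: v) (fun l => (l == m)%:R *: v).
Proof.
have [mn|nm] := ltnP m n.
  apply: Opow_eq (Opow0 V n) => x; rewrite (bigD1 (Ordinal mn))//= eqxx scale1r.
  rewrite big1 ?addr0 ?subrr// => i /eqP im.
  have /negPf -> : i != m :> nat by apply/eqP => E; apply: im; exact: val_inj.
  by rewrite scale0r scaler0.
have H : Opow (nbhs (0 : R)) m (fun x : R => x ^+ m *: v).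
  rewrite -[X in Opow _ X]addn0.
  by apply: OpowM; [exact: Opow_expr|exact: Opow_cst].
apply: Opow_eq (Opow_lower cvg_id nm H) => x.
rewrite big1 ?subr0// => i _.
by rewrite ltn_eqF ?scale0r ?scaler0// (leq_trans _ nm).
Qed.

(** The exponential is its own derivative and the partial sums of its series
    are the iterated primitives. *)
Lemma jet_expR (R : realType) (n : nat) :
  jet n (@expR R) (\poly_(i < n) (i`!%:R)^-1).
Proof.
elim: n => [|n IHn].
  have bd : Opow (nbhs (0 : R)) 0 (@expR R).
    by apply: Opow_cont; exact: continuous_expR.
  apply: Opow_eq bd => x.
  by rewrite poly_def big_ord0 horner0 subr0.
have -> : \poly_(i < n.+1) (i`!%:R)^-1 =
    (expR 0)%:P + primitive (\poly_(i < n) (i`!%:R)^-1) :> {poly R}.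
  apply/polyP => -[|i]; rewrite coefD coefC coef_primitive !coef_poly/=.
    by rewrite invr0 mulr0 addr0 expR0 fact0 invr1.
  rewrite add0r ltnS; case: ifP => _; last by rewrite mul0r.
  by rewrite factS natrM invfM mulrC.
by apply: jet_primitive IHn; near=> x; exact: is_derive_expR.
Unshelve. all: by end_near. Qed.

Lemma expansion_expR (R : realType) (n : nat) :
  expansion n (fun x : R => expR x *: (const_mx 1 : 'rV[R]_1))
    (fun l => (l`!%:R)^-1 *: const_mx 1).
Proof.
have /expansion_jets : forall j : 'I_1,
    jet n (fun x : R => (expR x *: (const_mx 1 : 'rV[R]_1)) 0 j)
      (\poly_(i < n) (i`!%:R)^-1).
  by move=> j; apply: Opow_eq (jet_expR R n) => x; rewrite !mxE mulr1.
apply: expansion_eq => // l ln; apply/rowP => j.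
by rewrite !mxE coef_poly ln mulr1.
Qed.

Lemma consistency_defect_coef (R : realType) (k n : nat) (hk : (0 < k)%N)
    (c alpha beta mu nu : int -> R)
    (cN1 : c (-1) = -1) (c0 : c 0 = 0) (alphaN1 : alpha (-1) = 1)
    (N : nat) (f : 'rV[R]_N -> 'rV[R]_N) (z : R -> 'rV[R]_N)
    (d : nat -> 'rV[R]_N) :
  consistency_order k c alpha beta mu nu n.+1 -> smooth f ->
  (\forall x \near (0 : R), is_derive x (1 : R) z (f (z x))) ->
  expansion n.+2 z d -> expansion n.+1 (f \o z) (fun l => l.+1%:R *: d l.+1) ->
  forall l, (l < n.+2)%N ->
    defect_coef k c alpha beta mu nu ('J f (z 0)) d l = 0.
Proof.
move=> /(consistency_order_defect _ hk beta mu nu cN1 c0 alphaN1) H.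
move=> sf Dz Hz Hf l ln.
have := H N f z sf Dz.
move=> /(expansion_Opow (defect_expansion k alpha beta mu nu c0 Hz Hf)).
move=> /(_ l ln).
by move/eqP; rewrite scaler_eq0 signr_eq0 => /eqP.
Qed.

(** Test problem y' = y, with solution e^x: here J y^(m) = y^(m+1), and the
    coefficient of h^(m+1) is a multiple of A_{m+1} + (m+1) M_m. *)
Lemma consistency_moment_combination (R : realType) (k n : nat) (hk : (0 < k)%N)
    (c alpha beta mu nu : int -> R)
    (cN1 : c (-1) = -1) (c0 : c 0 = 0) (alphaN1 : alpha (-1) = 1) :
  consistency_order k c alpha beta mu nu n.+1 ->
  moment k c alpha (fun i => - beta i) 0 = 0 /\
  forall m, (m <= n)%N -> moment k c alpha (fun i => - beta i) m.+1 +
    m.+1%:R * moment k c mu nu m = 0.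
Proof.
move=> H.
pose v : 'rV[R]_1 := const_mx 1.
pose f := ridge 0 v 0 'X.
pose z x := expR x *: v.
have fz x : f (z x) = z x.
  by rewrite /f /ridge add0r hornerX /z !mxE mulr1.
have Hf m : expansion m (f \o z) (fun l => l.+1%:R *: (((l.+1)`!%:R)^-1 *: v)).
  apply: expansion_eq (expansion_expR R m) => [x|l _]; first by rewrite /= fz.
  by rewrite scalerA factS natrM invfM mulVKf// pnatr_eq0.
have Dz : \forall x \near (0 : R), is_derive x (1 : R) z (f (z x)).
  by near=> x; rewrite fz; exact: is_derive_scalel.
have sf : smooth f by exact: smooth_ridge.
have C l ln := consistency_defect_coef hk cN1 c0 alphaN1 H sf Dz
  (expansion_expR R n.+2) (Hf n.+1) (l := l) ln.
split=> [|m mn].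
  have /rowP/(_ 0) := C 0 isT.
  by rewrite /defect_coef addr0 fact0 invr1 !mxE !mulr1.
have /rowP/(_ 0) := C m.+1 mn.
rewrite /defect_coef jacobian_ridge derivX hornerC !mxE mul1r !mulr1.
have m0 : (m`!%:R : R) != 0 by rewrite pnatr_eq0 -lt0n fact_gt0.
rewrite factS natrM => E; apply: (mulIf (invr_neq0 m0)); rewrite mul0r.
rewrite -[RHS](mulr0 m.+1%:R) -E; field.
by rewrite m0 nat1r pnatr_eq0.
Unshelve. all: by end_near. Qed.

(** Test problem y = (x, x^(m+1)), that is f(y1, y2) = (1, (m+1) y1^m). At the
    origin the Jacobian vanishes unless m = 1, so the mu part drops out
    and the second coordinate isolates A_{m+1}. For m = 1 the mu part remains,
    and only the combined condition of order two is forced. *)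
Lemma consistency_moment_alpha (R : realType) (k n : nat) (hk : (0 < k)%N)
    (c alpha beta mu nu : int -> R)
    (cN1 : c (-1) = -1) (c0 : c 0 = 0) (alphaN1 : alpha (-1) = 1) (m : nat) :
  consistency_order k c alpha beta mu nu n.+1 -> (m <= n)%N -> m != 1%N ->
  moment k c alpha (fun i => - beta i) m.+1 = 0.
Proof.
move=> H mn m1.
pose e (i : 'I_2) : 'rV[R]_2 := delta_mx 0 i.
pose f := ridge (e 0) (e 1) 0 (m.+1%:R *: 'X^m).
pose z x : 'rV[R]_2 := x ^+ 1 *: e 0 + x ^+ m.+1 *: e 1.
have z0 x : z x 0 0 = x by rewrite !mxE /= mulr1 mulr0 addr0.
have fz x : f (z x) = x ^+ 0 *: e 0 + x ^+ m *: (m.+1%:R *: e 1).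
  by rewrite /f /ridge z0 hornerZ hornerXn scalerA mulrC scale1r.
pose d (l : nat) := (l == 1%N)%:R *: e 0 + (l == m.+1)%:R *: e 1.
have Hz j : expansion j z d.
  by apply: expansionD; exact: expansion_monomial.
have Hf j : expansion j (f \o z) (fun l => l.+1%:R *: d l.+1).
  apply: expansion_eq (expansionD (expansion_monomial j 0 (e 0))
    (expansion_monomial j m (m.+1%:R *: e 1))) => [x|l _].
    by rewrite /= fz.
  rewrite /d !eqSS scalerDr !scalerA; congr (_ *: _ + _ *: _).
    by case: eqP => [->|_]; rewrite ?mulr1 ?mulr0.
  by case: eqP => [->|_]; rewrite ?mul1r ?mulr1 ?mul0r ?mulr0.
have Dz : \forall x \near (0 : R), is_derive x (1 : R) z (f (z x)).
  near=> x; rewrite fz scalerA mulrC.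
  have DX j : is_derive x (1 : R) (fun s : R => s ^+ j.+1) (j.+1%:R * x ^+ j).
    have := is_derive_poly ('X^(j.+1) : {poly R}) x.
    rewrite derivXn hornerMn hornerXn mulr_natl.
    by have -> : horner ('X^(j.+1) : {poly R}) = (fun s => s ^+ j.+1)
      by apply/funext => s; rewrite hornerXn.
  have D1 := is_derive_scalel (e 0) (DX 0).
  have D2 := is_derive_scalel (e 1) (DX m).
  have := is_deriveD D1 D2; by rewrite mul1r.
have sf : smooth f by exact: smooth_ridge.
have /rowP/(_ 1) := consistency_defect_coef hk cN1 c0 alphaN1 H sf Dz
  (Hz n.+2) (Hf n.+1) (l := m.+1) mn.
rewrite /defect_coef jacobian_ridge z0 derivZ derivXn hornerZ hornerMn hornerXn.
(* Up to the factor m + 1, the entry of the Jacobian at the origin. *)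
have -> : (0 : R) ^+ m.-1 *+ m = 0.
  by case: m m1 {f z z0 fz d Hz Hf Dz sf mn} => [|[|m]] // _;
    rewrite expr0n mul0rn.
by rewrite mulr0 mul0r scale0r scaler0 addr0 /d eqxx !mxE /= mulr0 add0r !mulr1.
Unshelve. all: by end_near. Qed.

(** * The order conditions *)

Theorem theorem3p6 (R : realType) (k p : nat) (hk : (1 <= k)%N) (hp : (1 <= p)%N)
    (c alpha beta mu nu : int -> R)
    (cN1 : c (-1) = -1) (c0 : c 0 = 0)
    (alphaN1 : alpha (-1) = 1) (betaN1 : beta (-1) = 0) (nuN1 : nu (-1) = 0) :
  consistency_order k c alpha beta mu nu p <->
  (sumN1 k alpha = 0 /\ sumN1 k mu = 0) /\
  sumN1 k (fun i => alpha i * c i) + \sum_(0 <= i < k) beta i%:Z = 0 /\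
  ((2 <= p)%N ->
     sumN1 k (fun i => alpha i * c i ^+ 2) +
     2 * sumN1 k (fun i => (beta i + mu i) * c i - nu i) = 0) /\
  (forall l : nat, (3 <= l <= p)%N ->
     sumN1 k (fun i => alpha i * c i ^+ l) +
     l%:R * \sum_(0 <= i < k) beta i%:Z * c i%:Z ^+ l.-1 = 0) /\
  (forall l : nat, (3 <= l <= p)%N ->
     sumN1 k (fun i => mu i * c i ^+ l.-1) -
     l.-1%:R * \sum_(0 <= i < k) nu i%:Z * c i%:Z ^+ l.-2 = 0).
Proof.
case: p hp => // n _.
set A := moment k c alpha (fun i => - beta i).
set M := moment k c mu nu.
have AE l : A l = sumN1 k (fun i => alpha i * c i ^+ l) +
    l%:R * \sum_(0 <= i < k) beta i%:Z * c i%:Z ^+ l.-1.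
  rewrite /A /moment -mulrN -sumrN; congr (_ + _ * _).
  by apply: eq_bigr => i _; rewrite mulNr opprK.
have A0 : A 0%N = sumN1 k alpha.
  rewrite AE mul0r addr0; congr sumN1.
  by apply/funext => i; rewrite expr0 mulr1.
have M0 : M 0%N = sumN1 k mu.
  rewrite /M /moment mul0r subr0; congr sumN1.
  by apply/funext => i; rewrite expr0 mulr1.
have A1 : A 1%N = sumN1 k (fun i => alpha i * c i) +
    \sum_(0 <= i < k) beta i%:Z.
  by rewrite AE mul1r; congr (_ + _); apply: eq_bigr => i _; rewrite mulr1.
have A2 : A 2%N + 2 * M 1%N = sumN1 k (fun i => alpha i * c i ^+ 2) +
     2 * sumN1 k (fun i => (beta i + mu i) * c i - nu i).
  rewrite AE -addrA -mulrDr; congr (_ + 2 * _).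
  have S : \sum_(0 <= i < k) nu i%:Z * c i%:Z ^+ 0 = \sum_(0 <= i < k) nu i%:Z.
    by apply: eq_bigr => i _; rewrite expr0 mulr1.
  rewrite /M /moment /sumN1 S betaN1 nuN1 add0r subr0 mul1r big_split/= sumrN.
  under [in RHS]eq_bigr do rewrite mulrDl.
  rewrite big_split/=.
  by rewrite /= expr1; ring.
rewrite -A0 -M0 -A1 -A2.
split=> [H|[[a0 m0] [a1 [a2 [al ml]]]]].
  have [a0 Eexp] := consistency_moment_combination hk cN1 c0 alphaN1 H.
  have Emon m mn m1 := consistency_moment_alpha hk cN1 c0 alphaN1 (m := m) H mn m1.
  (* Where A_{m+1} vanishes, the exponential problem leaves only M_m. *)
  have Mz m : (m <= n)%N -> m != 1%N -> M m = 0.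
    move=> mn m1; have := Eexp m mn; rewrite Emon// add0r => /eqP.
    by rewrite mulf_eq0 pnatr_eq0 => /eqP.
  do !split => //.
  - exact: Mz.
  - exact: Emon.
  - by move=> n1; exact: (Eexp 1%N n1).
  - move=> [|l] //; rewrite -AE => /andP[l3 ln].
    by apply: Emon => //; case: l l3 {ln} => [|[]].
  - move=> [|l] // /andP[l3 ln].
    by apply: (Mz l) => //; case: l l3 {ln} => [|[]].
apply/(consistency_order_defect _ hk beta mu nu cN1 c0 alphaN1) => N f z sf Dz.
have [d [Hz Hf d2]] := solution_expansion n sf Dz.
apply/(expansion_Opow (defect_expansion k alpha beta mu nu c0 Hz Hf)).
case=> [|[|[|l]]] ln; rewrite /defect_coef -/A -/M.
- by rewrite a0 scale0r addr0 scaler0.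
- by rewrite a1 m0 !scale0r addr0 scaler0.
- by rewrite -d2// scalerA -scalerDl [_ * 2]mulrC a2// scale0r scaler0.
- have -> : A l.+3 = 0 by rewrite AE al.
  have -> : M l.+2 = 0 by exact: (ml l.+3).
  by rewrite !scale0r addr0 scaler0.
Qed.
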